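(* For all integers $k\geq 1$: $k+1\in H(k+1,k)$, $2k-1\in H(k+2,k)$ and $2^{k-1}+1\in H(2k-1,k)$.
   Context: Let $\mathbb{H}^n:=\{0,1\}^n\subset\mathbb{R}^n$. For integers $n\geq k\geq 1$, $H(n,k)$ denotes the set of non-zero cardinalities of intersections of $\mathbb{H}^n$ with $k$-dimensional affine subspaces of $\mathbb{R}^n$: $H(n,k)=\{t>0:\exists\, S\subset\mathbb{R}^n \text{ affine subspace},\ \dim S=k,\ t=|\mathbb{H}^n\cap S|\}$. Equivalently (by the symmetries of the hypercube), with $m=n-k$, $H(n,k)=\{t:\exists\, L:\mathbb{R}^k\to\mathbb{R}^m \text{ linear},\ t=|\mathbb{H}^k\cap L^{-1}(\mathbb{H}^m)|\}$. *)

(* Defs.v *)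
From mathcomp Require Import all_boot all_algebra.
From mathcomp Require Import classical_sets cardinality reals.

Set Implicit Arguments.
Unset Strict Implicit.
Unset Printing Implicit Defensive.

Import GRing.Theory.
Local Open Scope classical_set_scope.
Local Open Scope card_scope.
Local Open Scope ring_scope.

Definition hypercube (R : realType) (n : nat) : set 'rV[R]_n :=
  [set x | forall i, x 0 i = 0 \/ x 0 i = 1].
Arguments hypercube : clear implicits.

Definition affine_subspace (R : realType) (n k : nat) (S : set 'rV[R]_n) : Prop :=
  exists (p : 'rV[R]_n) (V : {vspace 'rV[R]_n}),
    \dim V = k /\ S = [set p + v | v in [set` V]].

(* [A #= `I_t] says that A is finite with exactly t elements. *)
Definition section_cardinalities (R : realType) (n k : nat) : set nat :=
  [set t | (0 < t)%N /\ exists S : set 'rV[R]_n,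
     affine_subspace k S /\ (hypercube R n `&` S #= `I_t)].

(* Main.v *)
Require Import Defs.
From mathcomp Require Import all_boot all_order all_algebra.
From mathcomp Require Import classical_sets cardinality reals.

Set Implicit Arguments.
Unset Strict Implicit.
Unset Printing Implicit Defensive.

Import Order.TTheory GRing.Theory Num.Theory.
Local Open Scope classical_set_scope.
Local Open Scope card_scope.
Local Open Scope ring_scope.

(** The graph of a linear map [L : R^k -> R^m] is a [k]-dimensional subspace of
    [R^(k+m)] meeting the cube in as many points as there are [x] in [{0,1}^k]
    with [L x] in [{0,1}^m].  Take
    - [L x = x_1 + ... + x_k]: the solutions are [0] and the unit vectors;
    - [L (y, z) = (s - z, s)] where [s = y_1 + ... + y_(k-1)]: the solutions have
      [s] in [{0,1}] if [z = 0] and [s = 1] if [z = 1];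
    - [L (y, z) = (y_1 - z, ..., y_(k-1) - z)]: [y] is arbitrary if [z = 0] and
      all ones if [z = 1]. *)

Lemma card_setT_finType (T : finType) : [set: T] #= `I_#|T|.
Proof.
apply/card_set_bijP; exists (fun t => enum_rank t : nat); split.
- by move=> t _ /=; exact: ltn_ord.
- by move=> s t _ _ /val_inj /enum_rank_inj.
- by move=> i /= lti; exists (enum_val (Ordinal lti)); rewrite ?enum_valK.
Qed.

Lemma hypercube_row_mx (R : realType) (m n : nat) (x : 'rV[R]_m) (y : 'rV[R]_n) :
  hypercube R (m + n)%N (row_mx x y) <-> hypercube R m x /\ hypercube R n y.
Proof.
split=> [xy|[hx hy] i].
  split=> i; first by have := xy (lshift n i); rewrite row_mxEl.
  by have := xy (rshift m i); rewrite row_mxEr.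
by case: (split_ordP i) => j ->; rewrite ?row_mxEl ?row_mxEr.
Qed.

(** The cube points of the graph of [x *m A] are determined by their first block [x], so counting
    the section means counting the admissible [x]. The map [f] lists these without repetition by a
    finite type, whose cardinality is then computed by rewriting. *)
Lemma section_cardinalities_graph (R : realType) (k m : nat) (A : 'M[R]_(k, m))
    (T : finType) (f : T -> 'rV[R]_k) :
    (0 < #|T|)%N -> injective f ->
    (forall x, hypercube R k x /\ hypercube R m (x *m A) <-> range f x) ->
  section_cardinalities R (k + m)%N k #|T|.
Proof.
move=> T0 f_inj fP; split=> //.
pose B := row_mx 1%:M A.
pose g : 'Hom('rV[R]_k, 'rV[R]_(k + m)) := linfun (mulmxr B).
have gE x : g x = row_mx x (x *m A) by rewrite lfunE /= mul_mx_row mulmx1.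
have g_inj : injective g by move=> x y; rewrite !gE => /eq_row_mx[].
exists [set 0 + v | v in [set` limg g]]; split.
  exists 0, (limg g); split=> //.
  (* An injective [g] has trivial kernel, so its image keeps the dimension [k] of the source. *)
  rewrite limg_dim_eq ?dimvf ?dim_matrix ?mul1r //.
  by rewrite (eqP (introT lker0P g_inj)) capv0.
rewrite (_ : _ `&` _ = range (g \o f)).
  apply: card_eq_trans (card_setT_finType T).
  by apply: inj_card_eq => s t _ _ /g_inj /f_inj.
apply/seteqP; split=> [y [cube [v /= /memv_imgP[x _ ->] xy]]|_ [t _ <-]].
  move: cube; rewrite -xy add0r gE hypercube_row_mx fP => -[t _ <-].
  by exists t => //=; rewrite gE.
split=> /=; first by rewrite gE hypercube_row_mx fP; exists t.
by exists (g (f t)); rewrite ?add0r //= memv_img ?memvf.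
Qed.

Lemma hypercube_ge0 (R : realType) (n : nat) (x : 'rV[R]_n) :
  hypercube R n x -> forall i, 0 <= x 0 i.
Proof. by move=> hx i; case: (hx i) => ->. Qed.

Lemma hypercube0 (R : realType) (n : nat) : hypercube R n 0.
Proof. by move=> i; rewrite mxE; left. Qed.

Lemma hypercube_const1 (R : realType) (n : nat) : hypercube R n (const_mx 1).
Proof. by move=> i; rewrite mxE; right. Qed.

Lemma hypercube_delta (R : realType) (n : nat) (j : 'I_n) :
  hypercube R n (delta_mx 0 j).
Proof. by move=> i; rewrite mxE eqxx; case: eqP; [right|left]. Qed.

Lemma rv1P (R : realType) (x : 'rV[R]_1) : x = const_mx (x 0 0).
Proof. by apply/rowP=> i; rewrite mxE ord1. Qed.

Lemma hypercube1P (R : realType) (x : 'rV[R]_1) :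
  hypercube R 1 x <-> x = 0 \/ x = const_mx 1.
Proof.
split=> [hx|[] ->]; [|exact: hypercube0|exact: hypercube_const1].
by rewrite [x]rv1P; case: (hx 0) => ->; [left; apply/rowP=> i; rewrite !mxE|right].
Qed.

Lemma delta_mx_mul_const1 (R : realType) (n : nat) (j : 'I_n) :
  delta_mx 0 j *m const_mx 1 = const_mx 1 :> 'rV[R]_1.
Proof. by rewrite -rowE; apply/rowP=> i; rewrite !mxE. Qed.

(** Multiplying by the all-ones column sums the coordinates, and nonnegative terms with sum zero all
    vanish. *)
Lemma hypercube_sum0 (R : realType) (n : nat) (x : 'rV[R]_n) :
  hypercube R n x -> x *m const_mx 1 = 0 :> 'rV_1 -> x = 0.
Proof.
move=> /hypercube_ge0 x_ge0 /rowP/(_ 0); rewrite !mxE => s0.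
apply/rowP=> i; rewrite mxE -[LHS]mulr1.
have := psumr_eq0P _ s0 => /(_ _ i isT); rewrite mxE; apply=> j _.
by rewrite mxE mulr1.
Qed.

Lemma hypercube_sum1 (R : realType) (n : nat) (x : 'rV[R]_n) :
    hypercube R n x -> x *m const_mx 1 = const_mx 1 :> 'rV_1 ->
  exists j, x = delta_mx 0 j.
Proof.
move=> hx s1; have [j xj|x0] := pickP (fun j => x 0 j == 1); last first.
  have x00 : x = 0.
    apply/rowP=> i; rewrite mxE; case: (hx i) => // xi.
    by have := x0 i; rewrite xi eqxx.
  move/rowP/(_ 0): s1; rewrite x00 mul0mx !mxE => /esym/eqP.
  by rewrite oner_eq0.
(* Removing the unit vector at a coordinate equal to 1 leaves a cube point with coordinate sum 0. *)
exists j; apply/eqP; rewrite -subr_eq0; apply/eqP/hypercube_sum0; last first.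
  by rewrite mulmxBl s1 delta_mx_mul_const1 subrr.
move=> i; rewrite !mxE eqxx /=; have [->|_] := eqVneq i j.
  by rewrite (eqP xj) subrr; left.
by rewrite subr0; exact: hx.
Qed.

(** Excludes the value [0 - z] at [z = 1] as a cube coordinate in the last two constructions. *)
Lemma opp1_neq01 (R : realType) : ~ (-1 = 0 :> R \/ -1 = 1 :> R).
Proof.
case=> /eqP; first by rewrite oppr_eq0 oner_eq0.
by rewrite lt_eqF // (lt_trans (ltrN10 _)) // ltr01.
Qed.

(** Indexing by [option 'I_n] makes the count [n.+1] immediate. *)
Definition origin_or_unit (R : realType) (n : nat) (t : option 'I_n) : 'rV[R]_n :=
  if t is Some j then delta_mx 0 j else 0.
Arguments origin_or_unit : clear implicits.

Lemma delta_mx0_inj (R : realType) (n : nat) :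
  injective (fun j : 'I_n => delta_mx 0 j : 'rV[R]_n).
Proof.
move=> i j /rowP/(_ i)/eqP; rewrite !mxE !eqxx /=.
by case: (eqVneq i j) => // _; rewrite oner_eq0.
Qed.

Lemma delta_mx0_neq0 (R : realType) (n : nat) (j : 'I_n) :
  delta_mx 0 j <> 0 :> 'rV[R]_n.
Proof. by move=> /rowP/(_ j)/eqP; rewrite !mxE !eqxx /= oner_eq0. Qed.

Lemma const1_neq0 (R : realType) : const_mx 1 <> 0 :> 'rV[R]_1.
Proof. by move=> /rowP/(_ 0)/eqP; rewrite !mxE oner_eq0. Qed.

Lemma origin_or_unit_inj (R : realType) (n : nat) :
  injective (origin_or_unit R n).
Proof.
case=> [i|] [j|] //=; first by move/delta_mx0_inj->.
- by move/delta_mx0_neq0.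
- by move/esym/delta_mx0_neq0.
Qed.

Lemma hypercube_sumP (R : realType) (n : nat) (x : 'rV[R]_n) :
  hypercube R n x /\ hypercube R 1 (x *m const_mx 1) <->
  range (origin_or_unit R n) x.
Proof.
split=> [[hx /hypercube1P[]]|[[j|] _ <-]] /=.
- by move/(hypercube_sum0 hx)->; exists None.
- by move=> /(hypercube_sum1 hx)[j ->]; exists (Some j).
- split; first exact: hypercube_delta.
  by rewrite delta_mx_mul_const1; exact: hypercube_const1.
- by rewrite mul0mx; split; exact: hypercube0.
Qed.

Lemma section_cardinalities_unit_vectors (R : realType) (k : nat) :
  section_cardinalities R (k + 1)%N k (k + 1)%N.
Proof.
have := section_cardinalities_graph _ (@origin_or_unit_inj R k) (@hypercube_sumP R k).
by rewrite card_option card_ord -[X in section_cardinalities _ _ _ X]addn1; apply.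
Qed.

(** Here [n] is [k - 1]. The summand [inl] indexes the layer [z = 0], with [n.+1] points, and [inr]
    the layer [z = 1], with [n] points. *)
Lemma section_cardinalities_two_layers (R : realType) (n : nat) :
  section_cardinalities R (n + 1 + 2)%N (n + 1)%N (n.+1 + n)%N.
Proof.
pose A : 'M[R]_(n + 1, 1 + 1) := block_mx (const_mx 1) (const_mx 1) (- 1%:M) 0.
pose f (t : option 'I_n + 'I_n) : 'rV[R]_(n + 1) := match t with
  | inl u => row_mx (origin_or_unit R n u) 0
  | inr j => row_mx (delta_mx 0 j) (const_mx 1)
  end.
have f_inj : injective f.
  case=> [u|i] [v|j] /eq_row_mx[].
  - by move/origin_or_unit_inj->.
  - by move=> _ /esym/const1_neq0.
  - by move=> _ /const1_neq0.
  - by move/delta_mx0_inj->.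
have AE y z : row_mx y z *m A = row_mx (y *m const_mx 1 - z) (y *m const_mx 1).
  by rewrite mul_row_block mulmxN mulmx1 mulmx0 addr0.
have := @section_cardinalities_graph R (n + 1)%N (1 + 1)%N A _ f _ f_inj.
rewrite card_sum card_option card_ord; apply=> // x.
split=> [|[[u|j] _ <-]].
- rewrite -[x]hsubmxK AE !hypercube_row_mx.
  move: (lsubmx x) (rsubmx x) => y z [[hy hz] [hyz hs]].
  have [u _ yE] := (hypercube_sumP y).1 (conj hy hs).
  case/hypercube1P: hz hyz => [-> _|-> hyz].
    by exists (inl u) => //=; rewrite yE.
  case: u yE hyz => [j|] /= <-; first by exists (inr j).
  (* In the layer [z = 1] the origin is excluded: it would give [s - z = -1]. *)
  by rewrite mul0mx sub0r => /(_ 0); rewrite !mxE => /opp1_neq01.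
- have [hu hs] := (hypercube_sumP (origin_or_unit R n u)).2 (ex_intro2 _ _ u I erefl).
  by rewrite /= AE subr0 !hypercube_row_mx; split; split=> //; exact: hypercube0.
- rewrite /= AE delta_mx_mul_const1 subrr !hypercube_row_mx.
  split; split; by [exact: hypercube_delta|exact: hypercube_const1|exact: hypercube0].
Qed.

(** Again [n] is [k - 1]. The solutions form a pyramid: the whole [n]-cube at [z = 0] is the base,
    and the all-ones point at [z = 1], indexed by [None], is the apex. *)
Lemma section_cardinalities_pyramid (R : realType) (n : nat) :
  section_cardinalities R (n + 1 + n)%N (n + 1)%N (2 ^ n).+1%N.
Proof.
pose A : 'M[R]_(n + 1, n) := col_mx 1%:M (const_mx (-1)).
pose b (g : {ffun 'I_n -> bool}) : 'rV[R]_n := \row_i (g i)%:R.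
pose f (t : option {ffun 'I_n -> bool}) : 'rV[R]_(n + 1) :=
  if t is Some g then row_mx (b g) 0 else row_mx (const_mx 1) (const_mx 1).
have b_inj : injective b.
  move=> g h /rowP gh; apply/ffunP=> i; have /eqP := gh i.
  by rewrite !mxE eqr_nat; case: (g i) (h i) => [] [].
have bP y : hypercube R n y <-> exists g, b g = y.
  split=> [hy|[g <-] i]; last by rewrite mxE; case: (g i); [right|left].
  exists [ffun i => y 0 i == 1]; apply/rowP=> i; rewrite mxE ffunE.
  by case: (hy i) => ->; rewrite ?eqxx // eq_sym oner_eq0.
have f_inj : injective f.
  case=> [g|] [h|] // /eq_row_mx[].
  - by move/b_inj->.
  - by move=> _ /esym/const1_neq0.
  - by move=> _ /const1_neq0.
have A0 (y : 'rV_n) : row_mx y 0 *m A = y by rewrite mul_row_col mulmx1 mul0mx addr0.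
have A1 (y : 'rV_n) : row_mx y (const_mx 1) *m A = y - const_mx 1.
  rewrite mul_row_col mulmx1; congr (_ + _); apply/rowP=> i.
  by rewrite !mxE big_ord1 !mxE mul1r.
have := section_cardinalities_graph _ f_inj.
move=> /(_ _ A); rewrite card_option card_ffun card_bool card_ord; apply=> // x.
split=> [|[[g|] _ <-] /=].
- rewrite -[x]hsubmxK hypercube_row_mx.
  move: (lsubmx x) (rsubmx x) => y z [[hy /hypercube1P[] -> {z}]].
    by case: ((bP y).1 hy) => g <- _; exists (Some g).
  (* At [z = 1] a coordinate 0 of [y] would be sent to -1, so every coordinate is 1. *)
  rewrite A1 => hy1; exists None => //=; congr row_mx; apply/rowP=> i.
  have := hy1 i; rewrite !mxE; case: (hy i) => -> //.
  by rewrite sub0r => /opp1_neq01.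
- have hb : hypercube R n (b g) by apply/bP; exists g.
  by rewrite A0 hypercube_row_mx; do !split=> //; exact: hypercube0.
- rewrite A1 subrr hypercube_row_mx.
  by split; [split; exact: hypercube_const1|exact: hypercube0].
Qed.

Local Close Scope ring_scope.

Theorem proposition2p1 (R : realType) (k : nat) (hk : (1 <= k)%N) :
  section_cardinalities R (k + 1) k (k + 1) /\
  section_cardinalities R (k + 2) k (2 * k - 1) /\
  section_cardinalities R (2 * k - 1) k (2 ^ (k - 1) + 1).
Proof.
split; first exact: section_cardinalities_unit_vectors.
case: k hk => // n _.
(* With [k = n.+1], this number is both the cardinality in the second claim and the ambient
   dimension in the third. *)
have -> : 2 * n.+1 - 1 = n.+1 + n by rewrite mul2n -addnn addnS subn1.
have two_layers := section_cardinalities_two_layers R n.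
have pyramid := section_cardinalities_pyramid R n.
by rewrite subSS subn0 addn1; rewrite !addn1 in two_layers pyramid.
Qed.
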